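(* Let $q=p^m$, where $p$ is prime and $m$ is a positive integer. Let $a,b,c,d\in\mathbb{F}_{q^2}$ be not all zero, and let $g(x)=\frac{d^qx^3+c^qx^2+b^qx+a^q}{ax^3+bx^2+cx+d}\in\mathbb{F}_{q^2}(x)$. Assume that $\deg(g)=1$. Then $g(x)$ permutes $\mu_{q+1}$ if and only if one of the following holds: (1) $d=0$, $c\neq 0$, $bc^q=ab^q$ and $c^{q+1}=a^{q+1}$; (2) $d=0$, $a=0$, and $c^{q+1}\neq b^{q+1}$; (3) $d\neq 0$, $d^qb\neq ac^q$, $d^qc\neq ab^q$, and $\left(\frac{d^qc-ab^q}{d^qb-ac^q}\right)^q\left(\frac{d^{q+1}-a^{q+1}}{d^qb-ac^q}\right)=\frac{d^qc-ab^q}{d^qb-ac^q}$; (4) $d\neq 0$, $d^qb\neq ac^q$, $d^qc=ab^q$, and $\frac{d^{q+1}-a^{q+1}}{d^qb-ac^q}=\frac{b^q}{d^q}\in\mu_{q+1}$.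
   Context: $\mu_{q+1}$ denotes the set of $(q+1)$-th roots of unity in $\mathbb{F}_{q^2}$. A rational function is identified with its reduced form $N_0/D_0$ with $N_0,D_0$ coprime; its degree is $\max(\deg N_0,\deg D_0)$, and it is viewed as a map on the projective line via the reduced form. A rational function permutes a set $S$ if it restricts to a bijection $S\to S$. *)

(* Defs.v *)
From HB Require Import structures.
From mathcomp Require Import all_boot all_order all_algebra all_field.

Set Implicit Arguments.
Unset Strict Implicit.
Unset Printing Implicit Defensive.

Import GRing.Theory.
Local Open Scope ring_scope.
Local Open Scope quotient_scope.

Notation "x %:F" := (@FracField.tofrac _ x) : ring_scope.

(* [repr f] is an arbitrary representative of the class f, not necessarily in *)
(* lowest terms. The reduced pair (ratnum f, ratden f) is determined by f up  *)
(* to a common nonzero scalar, on which neither [ratdeg] nor [rateval] depend *)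
Definition ratnum (K : fieldType) (f : {fraction {poly K}}) : {poly K} :=
  let r := repr f in \n_r %/ gcdp \n_r \d_r.

Definition ratden (K : fieldType) (f : {fraction {poly K}}) : {poly K} :=
  let r := repr f in \d_r %/ gcdp \n_r \d_r.

Definition ratdeg (K : fieldType) (f : {fraction {poly K}}) : nat :=
  maxn (size (ratnum f)).-1 (size (ratden f)).-1.

(* The projective line over K is [option K], with [None] the point at         *)
(* infinity. The value at infinity is the ratio of the coefficients of degree *)
(* [ratdeg f], i.e. the value at [1 : 0] of the homogenized reduced form.     *)
Definition rateval (K : fieldType) (f : {fraction {poly K}}) (P : option K) :
    option K :=
  let mkpt (u v : K) := if v == 0 then None else Some (u / v) in
  match P with
  | Some x => mkpt (ratnum f).[x] (ratden f).[x]
  | None => mkpt (ratnum f)`_(ratdeg f) (ratden f)`_(ratdeg f)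
  end.

Definition permutes_on (T : eqType) (f : T -> T) (S : {pred T}) : Prop :=
  [/\ {in S, forall x, f x \in S},
      {in S &, injective f} &
      {in S, forall y, exists2 x, x \in S & f x = y}].

Definition mu (K : finFieldType) (n : nat) : {set K} :=
  [set x | n.-unity_root x].

Definition rat_permutes (K : finFieldType) (f : {fraction {poly K}})
    (S : {set K}) : Prop :=
  permutes_on (rateval f) (mem [set Some x | x in S]).

(* Main.v *)
Require Import Defs.
From HB Require Import structures.
From mathcomp Require Import all_boot all_order all_algebra all_field.
From mathcomp Require Import ring.

Set Implicit Arguments.
Unset Strict Implicit.
Unset Printing Implicit Defensive.

Import GRing.Theory.
Local Open Scope ring_scope.

(** The two sides of the equivalence hold unconditionally as soon as g has
    degree one, so each is proved separately.

    Write s x = x^q for the involutive automorphism of F over its subfield of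
    order q, and for a form P of degree k let P* be its conjugate reciprocal,
    x^k (s P)(1/x).  With D = a x^3 + b x^2 + c x + d the fraction is g = D*/D.
    If n/e is its reduced form then D* = h n and D = h e, where the cofactor h
    is a quadratic form and n, e are linear forms with nonzero determinant
    del = n1 e0 - n0 e1.  Applying * to both factorizations gives h n = h* e*
    and h e = h* n*, so that h* e* e = h n e = h* n* n, and e* e = n* n.  As n
    and e are coprime, n divides e*, that is e* = l n for a scalar l, and then
    h = l h*; conjugating the latter shows l s(l) = 1.  This is
    [conj_star_factorization].

    Permutation ([rat_permutes_mu]): for x in mu_{q+1} one has s x = 1/x, so
    e* = l n reads x s(e(x)) = l n(x), whence g(x) = x s(e(x)) / (l e(x)) has
    norm one.  Moreover e has no zero on mu_{q+1}, for it would be common to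
    e and n.  So g maps the finite set mu_{q+1} to itself, and it is injective
    because del is not zero.

    Conditions ([reduced_form_conditions]): expanding a, ..., d and their
    conjugates in terms of h, n, e gives
      d^q b - a c^q = h2^2 del,      d^q c - a b^q = h2 h1 del,
      d^(q+1) - a^(q+1) = h2 h0 del,
    so that the quotients in the last two conditions are h1 / h2 and h0 / h2,
    and h = l h* yields the required relations between them.  If d = 0, then
    either a = 0 as well, which makes h a multiple of x, or g is a constant
    times 1/x. *)

(** * Reduced form of a rational function *)

Lemma frac_repr (K : fieldType) (f : {fraction {poly K}}) :
  f = (\n_(repr f))%:F / (\d_(repr f))%:F.
Proof.
have d0 : \d_(repr f) != 0 by apply: denom_ratioP.
have D0 : (\d_(repr f))%:F != 0 :> {fraction {poly K}} by rewrite tofrac_eq0.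
apply: (mulIf D0); rewrite divfK //.
rewrite -{1}[f](@reprK _ _) /FracField.tofrac; unlock.
rewrite -[LHS]FracField.pi_mul; apply/eqmodP.
rewrite /= FracField.equivfE /FracField.mulf.
by rewrite !numden_Ratio ?oner_eq0 ?mulr1 ?mulf_neq0 ?oner_neq0 // mulrC.
Qed.

Lemma ratden_neq0 (K : fieldType) (f : {fraction {poly K}}) : ratden f != 0.
Proof.
have d0 : \d_(repr f) != 0 by apply: denom_ratioP.
rewrite /ratden dvdp_div_eq0 ?dvdp_gcdr //.
Qed.

Lemma coprimep_ratnum_ratden (K : fieldType) (f : {fraction {poly K}}) :
  coprimep (ratnum f) (ratden f).
Proof. by apply: coprimep_div_gcd; rewrite (denom_ratioP (repr f)) orbT. Qed.

(** Divisibility comes from the cross product N * v = u * D, where u / v is the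
    reduced form, and coprimality of u and v. *)
Lemma ratnum_ratden_factor (K : fieldType) (N D : {poly K})
    (f : {fraction {poly K}}) :
  D != 0 -> f = N%:F / D%:F ->
  exists2 h, N = h * ratnum f & D = h * ratden f.
Proof.
move=> D0 fE; set u := ratnum f; set v := ratden f.
have v0 : v != 0 := ratden_neq0 f.
pose k := gcdp \n_(repr f) \d_(repr f).
have k0 : k != 0 by rewrite gcdp_eq0 negb_and (denom_ratioP (repr f)) orbT.
have nE : \n_(repr f) = u * k by rewrite divpK ?dvdp_gcdl.
have dE : \d_(repr f) = v * k by rewrite divpK ?dvdp_gcdr.
have cross : N * v = u * D.
  apply: (mulIf k0); rewrite -mulrA [RHS]mulrAC; apply/eqP.
  rewrite -tofrac_eq !tofracM -eqr_div ?mulf_neq0 ?tofrac_eq0 //.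
  rewrite -fE -!tofracM -nE -dE; apply/eqP; exact: frac_repr.
have vD : v %| D.
  rewrite -(@Gauss_dvdpr _ D u v); last first.
    by rewrite coprimep_sym coprimep_ratnum_ratden.
  by rewrite -cross dvdp_mull.
exists (D %/ v); last by rewrite divpK.
by apply: (mulIf v0); rewrite cross -{1}(divpK vD); ring.
Qed.

Lemma ratdeg1_sizes (K : fieldType) (f : {fraction {poly K}}) :
  ratdeg f = 1%N -> (size (ratnum f) <= 2)%N /\ (size (ratden f) <= 2)%N.
Proof.
move=> deg1; move: (leq_maxl (size (ratnum f)).-1 (size (ratden f)).-1).
move: (leq_maxr (size (ratnum f)).-1 (size (ratden f)).-1).
rewrite -/(ratdeg f) deg1.
by case: (size _) => [|[|[]]] //; case: (size _) => [|[|[]]].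
Qed.

(** If the determinant vanished, the zero of whichever of the two polynomials is
    not constant would be a common root. *)
Lemma ratdeg1_det (K : fieldType) (f : {fraction {poly K}}) :
  ratdeg f = 1%N ->
  (ratnum f)`_1 * (ratden f)`_0 - (ratnum f)`_0 * (ratden f)`_1 != 0.
Proof.
move=> deg1; have [su sv] := ratdeg1_sizes deg1.
have cuv := coprimep_ratnum_ratden f; have muv := deg1; rewrite /ratdeg in muv.
set u := ratnum f in su cuv muv *; set v := ratden f in sv cuv muv *.
apply/eqP=> /eqP; rewrite subr_eq0 => /eqP dE.
have lin (w : {poly K}) x : (size w <= 2)%N -> w.[x] = w`_0 + w`_1 * x.
  move=> sw; rewrite (horner_coef_wide x sw) !big_ord_recl big_ord0.
  by rewrite mulr1 addr0.
have com (w z : {poly K}) : (size w <= 2)%N -> (size z <= 2)%N ->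
    w`_1 != 0 -> w`_1 * z`_0 = w`_0 * z`_1 -> coprimep w z -> False.
  move=> sw sz w1 E cwz.
  have rw : root w (- w`_0 / w`_1).
    by rewrite /root lin // mulrC divfK // subrr.
  have /eqP[] := coprimep_root cwz rw; rewrite lin //.
  by apply: (mulfI w1); rewrite mulrDr E mulr0; field.
have [u1|u1] := eqVneq u`_1 0; last exact: (com u v).
have [v1|v1] := eqVneq v`_1 0; last first.
  apply: (com v u) => //; last by rewrite coprimep_sym.
  by rewrite mulrC -dE mulrC.
have c0 (w : {poly K}) : (size w <= 2)%N -> w`_1 = 0 -> ((size w).-1 = 0)%N.
  move=> sw w1; apply/eqP; rewrite -leqn0 -subn1 leq_subLR addn0.
  apply/leq_sizeP=> -[|[|j]] // _; exact: (leq_sizeP _ _ sw).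
by rewrite !c0 in muv.
Qed.

(** * Linear and quadratic polynomials by their coefficients *)

Lemma Poly_coefs (K : fieldType) (k : nat) (p : {poly K}) :
  (size p <= k)%N -> p = Poly (mkseq (fun i => p`_i) k).
Proof.
move=> sp; apply/polyP=> i; rewrite coef_Poly.
have [ik|ki] := ltnP i k; first by rewrite nth_mkseq.
by rewrite !nth_default ?size_mkseq // (leq_trans sp).
Qed.

Lemma mul_Poly_quad_lin (K : comNzRingType) (h2 h1 h0 l1 l0 : K) :
  Poly [:: h0; h1; h2] * Poly [:: l0; l1] =
  Poly [:: h0 * l0; h1 * l0 + h0 * l1; h2 * l0 + h1 * l1; h2 * l1].
Proof. by rewrite /= !cons_poly_def; ring. Qed.

Lemma mul_Poly_lin_lin (K : comNzRingType) (k1 k0 l1 l0 : K) :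
  Poly [:: k0; k1] * Poly [:: l0; l1] =
  Poly [:: k0 * l0; k1 * l0 + k0 * l1; k1 * l1].
Proof. by rewrite /= !cons_poly_def; ring. Qed.

Lemma Poly_inj4 (K : nzRingType) (x0 x1 x2 x3 y0 y1 y2 y3 : K) :
  Poly [:: x0; x1; x2; x3] = Poly [:: y0; y1; y2; y3] ->
  [/\ x0 = y0, x1 = y1, x2 = y2 & x3 = y3].
Proof.
move/polyP=> E; split;
  [have:= E 0%N | have:= E 1%N | have:= E 2%N | have:= E 3%N];
  by rewrite !coef_Poly.
Qed.

(** * Factorization of the numerator and denominator *)

(** The linear forms n = n0 + n1 x and e = e0 + e1 x have no common zero, even
    at infinity, so n can divide the product (E1 + E0 x) e only if E1 + E0 x is
    a multiple of n.  Coefficients are used because n may be constant, with its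
    zero at infinity, and then polynomial divisibility says nothing. *)
Lemma linear_star_proportional (K : fieldType) (n1 n0 e1 e0 N1 N0 E1 E0 : K) :
  n1 * e0 - n0 * e1 != 0 ->
  Poly [:: E1; E0] * Poly [:: e0; e1] = Poly [:: N1; N0] * Poly [:: n0; n1] ->
  exists l, E0 = l * n1 /\ E1 = l * n0.
Proof.
move=> d0; rewrite !mul_Poly_lin_lin => /polyP E.
have:= E 0%N; have:= E 1%N; have := E 2%N; rewrite !coef_Poly /= => c2 c1 c0.
have X : E0 * n0 = E1 * n1.
  (* (E0 n0 - E1 n1) (n1 e0 - n0 e1) is a combination of the relations c_i.   *)
  apply: (mulIf d0).
  have -> : E1 * n1 * (n1 * e0 - n0 * e1) =
      n1 * (n1 * (E1 * e0) - n0 * (E0 * e0 + E1 * e1)) + n0 * n1 * (E0 * e0).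
    by ring.
  rewrite c0 c1.
  have -> : n1 * (n1 * (N1 * n0) - n0 * (N0 * n0 + N1 * n1)) =
      - (n0 * n0 * (N0 * n1)) by ring.
  by rewrite -c2; ring.
have [n10|n10] := eqVneq n1 0.
  have n00 : n0 != 0.
    by apply: contraNneq d0 => ->; rewrite n10 !mul0r subrr.
  exists (E1 / n0); rewrite divfK // n10 mulr0; split=> //.
  by apply: (mulIf n00); rewrite X n10 mulr0 mul0r.
exists (E0 / n1); rewrite divfK //; split=> //.
by rewrite mulrAC X mulfK.
Qed.

(** If D* = h n and D = h e with n, e coprime linear forms, then e* = l n and
    h = l h*, where l has norm one.  The involution s stands for x |-> x^q. *)
Lemma conj_star_factorization (K : fieldType) (s : K -> K)
    (sD : {morph s : x y / x + y}) (sM : {morph s : x y / x * y})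
    (sK : involutive s) (a b c d h2 h1 h0 n1 n0 e1 e0 : K) :
  ~ [/\ a = 0, b = 0, c = 0 & d = 0] ->
  n1 * e0 - n0 * e1 != 0 ->
  Poly [:: s a; s b; s c; s d] = Poly [:: h0; h1; h2] * Poly [:: n0; n1] ->
  Poly [:: d; c; b; a] = Poly [:: h0; h1; h2] * Poly [:: e0; e1] ->
  exists l, [/\ s e0 = l * n1, s e1 = l * n0, l * s l = 1
    & [/\ h2 = l * s h0, h1 = l * s h1 & h0 = l * s h2]].
Proof.
move=> nz d0 EN ED.
set P := Poly [:: h0; h1; h2] in EN ED.
(* Ps is the conjugate reciprocal of P; the same star operation turns the     *)
(* cubic with coefficients a, b, c, d into the one with s d, s c, s b, s a.   *)
pose Ps := Poly [:: s h2; s h1; s h0].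
have P0 : P != 0.
  apply/eqP=> P0; apply: nz; move: ED; rewrite P0 mul0r => /polyP E.
  split; [have:= E 3%N | have:= E 2%N | have:= E 1%N | have:= E 0%N];
    by rewrite coef_Poly coef0.
have n_neq0 : Poly [:: n0; n1] != 0.
  apply: contraNneq d0 => /polyP E.
  have:= E 0%N; have:= E 1%N; rewrite !coef_Poly !coef0 /= => -> ->.
  by rewrite !mul0r subrr.
have s0 : s 0 = 0 by apply: (addrI (s 0)); rewrite -sD !addr0.
have starN : P * Poly [:: n0; n1] = Ps * Poly [:: s e1; s e0].
  move: ED; rewrite -EN /P /Ps !mul_Poly_quad_lin.
  case/Poly_inj4=> -> -> -> ->; rewrite !(sD, sM).
  by congr (Poly [:: _; _; _; _]); ring.
have starD : P * Poly [:: e0; e1] = Ps * Poly [:: s n1; s n0].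
  move: EN; rewrite -ED /P /Ps !mul_Poly_quad_lin.
  case/Poly_inj4=> /(congr1 s) + /(congr1 s) + /(congr1 s) + /(congr1 s).
  by rewrite !sK !(sD, sM) => -> -> -> ->; congr (Poly [:: _; _; _; _]); ring.
have Ps0 : Ps != 0.
  apply: contra_neq P0 => Z.
  by apply: (mulIf n_neq0); rewrite starN Z !mul0r.
have [l [le0 le1]] : exists l, s e0 = l * n1 /\ s e1 = l * n0.
  apply: (@linear_star_proportional _ _ _ e1 e0 (s n1) (s n0)) => //.
  apply: (mulfI Ps0); rewrite !mulrA -starN -starD; ring.
exists l.
have Pl : P = l%:P * Ps.
  apply: (mulIf n_neq0); rewrite starN le0 le1 /= !cons_poly_def; ring.
have [h0E h1E h2E] : [/\ h0 = l * s h2, h1 = l * s h1 & h2 = l * s h0].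
  move/polyP: Pl => E; split; [have:= E 0%N | have:= E 1%N | have:= E 2%N];
    by rewrite coefCM !coef_Poly.
split=> //.
have ll x y : x = l * s y -> y = l * s x -> x != 0 -> l * s l = 1.
  move=> xE yE x0; apply: (mulIf x0).
  by rewrite mul1r {2}xE {1}yE sM sK -mulrA.
have [h00|h00] := eqVneq h0 0; last exact: (ll h0 h2).
have [h10|h10] := eqVneq h1 0; last exact: (ll h1 h1).
case/eqP: P0; rewrite /P h2E h10 h00 s0 mulr0 /= !cons_poly_def; ring.
Qed.

(** * Permutation of the roots of unity *)

Lemma permutes_on_finP (T : finType) (f : T -> T) (S : {set T}) :
  {in S, forall x, f x \in S} -> {in S &, injective f} ->
  permutes_on f (mem S).
Proof.
move=> fS fI; split=> // y yS.
have /eqP E : [set f x | x in S] == S.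
  rewrite eqEcard card_in_imset // leqnn andbT.
  by apply/subsetP=> _ /imsetP[x xS ->]; apply: fS.
have : y \in [set f x | x in S] by rewrite E.
by case/imsetP=> x xS ->; exists x.
Qed.

(** On mu_{q+1} the relation e* = l n says that e(x) and n(x) have the same
    norm, since conjugation inverts x; being coprime they do not both vanish. *)
Lemma rat_permutes_mu (F : finFieldType) (q : nat) (f : {fraction {poly F}})
    (n1 n0 e1 e0 l : F) :
  (0 < q)%N ->
  (forall x y : F, (x + y) ^+ q = x ^+ q + y ^+ q) ->
  (forall x : F, x ^+ q ^+ q = x) ->
  ratnum f = Poly [:: n0; n1] -> ratden f = Poly [:: e0; e1] ->
  n1 * e0 - n0 * e1 != 0 ->
  e0 ^+ q = l * n1 -> e1 ^+ q = l * n0 -> l * l ^+ q = 1 ->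
  rat_permutes f (mu F q.+1).
Proof.
move=> q0 qD qK nE eE d0 le0 le1 ll.
pose N x := n0 + n1 * x; pose E x := e0 + e1 * x.
have l0 : l != 0.
  by apply: contra_eq_neq ll => ->; rewrite mul0r eq_sym oner_neq0.
have evalE x : E x != 0 -> rateval f (Some x) = Some (N x / E x).
  move=> Ex; rewrite /rateval nE eE /= !horner_cons horner0 !mul0r !add0r.
  by rewrite ![_ * x + _]addrC -/(E x) (negPf Ex).
have muE x : (x \in mu F q.+1) = (x * x ^+ q == 1).
  by rewrite inE unity_rootE exprS.
have conjE x : x \in mu F q.+1 -> x * E x ^+ q = l * N x.
  rewrite muE => /eqP xx; rewrite qD exprMn le0 le1 mulrDr.
  have -> : x * (l * n0 * x ^+ q) = l * n0 * (x * x ^+ q) by ring.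
  by rewrite xx /N; ring.
have Enz x : x \in mu F q.+1 -> E x != 0.
  move=> xmu; apply: contraNneq d0 => Ex.
  have Nx : N x = 0.
    apply: (mulfI l0); rewrite -conjE // Ex mulr0.
    by rewrite expr0n (gtn_eqF q0) mulr0.
  have -> : n1 * e0 - n0 * e1 = n1 * E x - e1 * N x by rewrite /N /E; ring.
  by rewrite Ex Nx !mulr0 subrr.
apply: permutes_on_finP.
  move=> _ /imsetP[x xmu ->]; rewrite evalE ?Enz //; apply: imset_f.
  have Ex := Enz x xmu; have Eq : E x ^+ q != 0 by rewrite expf_neq0.
  have xx : x * x ^+ q = 1 by apply/eqP; rewrite -muE.
  rewrite muE expr_div_n mulf_div -(inj_eq (mulIf (mulf_neq0 Ex Eq))).
  rewrite divfK ?mulf_neq0 // mul1r.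
  have cE := conjE x xmu; have := congr1 (fun z => z ^+ q) cE.
  rewrite !exprMn qK => cE'.
  apply/eqP; rewrite -[LHS]mul1r -ll.
  have -> : l * l ^+ q * (N x * N x ^+ q) = (l * N x) * (l ^+ q * N x ^+ q).
    by ring.
  rewrite -cE -cE'.
  have -> : x * E x ^+ q * (x ^+ q * E x) = x * x ^+ q * (E x * E x ^+ q).
    by ring.
  by rewrite xx mul1r.
move=> _ _ /imsetP[x xmu ->] /imsetP[y ymu ->].
have Ex := Enz x xmu; have Ey := Enz y ymu.
rewrite !evalE //; case=> /eqP; rewrite eqr_div // => /eqP xy; congr Some.
apply/eqP; rewrite -subr_eq0; apply/eqP; apply: (mulfI d0); rewrite mulr0.
transitivity (N x * E y - N y * E x); first by rewrite /N /E; ring.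
by rewrite xy subrr.
Qed.

(** * Conditions on the coefficients *)

(** The cases follow the vanishing of d and a, then that of h1.  The relation
    h = l h* makes h2 and h0 vanish together. *)
Lemma reduced_form_conditions (F : finFieldType) (q : nat)
    (a b c d h2 h1 h0 n1 n0 e1 e0 l : F) :
  (0 < q)%N ->
  ~ [/\ a = 0, b = 0, c = 0 & d = 0] ->
  n1 * e0 - n0 * e1 != 0 ->
  Poly [:: a ^+ q; b ^+ q; c ^+ q; d ^+ q] =
    Poly [:: h0; h1; h2] * Poly [:: n0; n1] ->
  Poly [:: d; c; b; a] = Poly [:: h0; h1; h2] * Poly [:: e0; e1] ->
  l * l ^+ q = 1 ->
  h2 = l * h0 ^+ q -> h1 = l * h1 ^+ q -> h0 = l * h2 ^+ q ->
  [\/ [/\ d = 0, c != 0, b * c ^+ q = a * b ^+ q & c ^+ q.+1 = a ^+ q.+1],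
      [/\ d = 0, a = 0 & c ^+ q.+1 != b ^+ q.+1],
      [/\ d != 0, d ^+ q * b != a * c ^+ q, d ^+ q * c != a * b ^+ q &
          ((d ^+ q * c - a * b ^+ q) / (d ^+ q * b - a * c ^+ q)) ^+ q
            * ((d ^+ q.+1 - a ^+ q.+1) / (d ^+ q * b - a * c ^+ q))
          = (d ^+ q * c - a * b ^+ q) / (d ^+ q * b - a * c ^+ q)] |
      [/\ d != 0, d ^+ q * b != a * c ^+ q, d ^+ q * c = a * b ^+ q,
          (d ^+ q.+1 - a ^+ q.+1) / (d ^+ q * b - a * c ^+ q)
            = b ^+ q / d ^+ q &
          b ^+ q / d ^+ q \in mu F q.+1]].
Proof.
move=> q0 nz d0; rewrite !mul_Poly_quad_lin => /Poly_inj4[aq bq cq dq].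
case/Poly_inj4=> dE cE bE aE ll h2E h1E h0E.
have l0 : l != 0.
  by apply: contra_eq_neq ll => ->; rewrite mul0r eq_sym oner_neq0.
have h02 : (h0 == 0) = (h2 == 0).
  by rewrite h0E mulf_eq0 (negPf l0) expf_eq0 q0.
set del := n1 * e0 - n0 * e1 in d0.
have [dz|dnz] := eqVneq d 0.
  have [az|anz] := eqVneq a 0.
    constructor 2; split=> //.
    (* If h2, hence h0, were nonzero, then e would vanish identically. *)
    have hz : h2 = 0.
      apply/eqP; apply: contraNT d0 => h2n; move: (h2n); rewrite -h02 => h0n.
      move: dE aE; rewrite dz az => /esym/eqP + /esym/eqP.
      rewrite !mulf_eq0 (negPf h0n) (negPf h2n) /= => /eqP e00 /eqP e10.
      by rewrite /del e00 e10 !mulr0 subrr.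
    have hz0 : h0 = 0 by apply/eqP; rewrite h02 hz.
    have h1n : h1 != 0.
      apply: contra_not_neq nz => h1z.
      by rewrite dE cE bE aE hz hz0 h1z !mul0r addr0.
    rewrite -subr_eq0 !exprS cq bq cE bE hz hz0.
    have -> : (h1 * e0 + 0 * e1) * (0 * n0 + h1 * n1) -
        (0 * e0 + h1 * e1) * (h1 * n0 + 0 * n1) = h1 * h1 * del.
      by rewrite /del; ring.
    by rewrite !mulf_neq0.
  (* Here n is constant and e is a multiple of x, so n / e is a multiple of   *)
  (* 1/x.                                                                     *)
  have [h2n e1n] : h2 != 0 /\ e1 != 0.
    by apply/andP; rewrite -negb_or -mulf_eq0 -aE.
  have h0n : h0 != 0 by rewrite h02.
  have e00 : e0 = 0 by apply: (mulfI h0n); rewrite -dE dz mulr0.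
  have n10 : n1 = 0.
    by apply: (mulfI h2n); rewrite -dq dz expr0n (gtn_eqF q0) mulr0.
  constructor 1; split=> //.
  - by rewrite cE e00 mulr0 add0r mulf_neq0.
  - by rewrite cq bq bE aE e00 n10; ring.
  - by rewrite !exprS cq aq cE aE e00 n10; ring.
have [h0n e0n] : h0 != 0 /\ e0 != 0.
  by apply/andP; rewrite -negb_or -mulf_eq0 -dE.
have h2n : h2 != 0 by rewrite -h02.
have n1n : n1 != 0.
  by apply: contraNneq (expf_neq0 q dnz) => n10; rewrite dq n10 mulr0.
have AE : d ^+ q * b - a * c ^+ q = h2 * h2 * del.
  by rewrite dq cq aE bE /del; ring.
have BE : d ^+ q * c - a * b ^+ q = h2 * h1 * del.
  by rewrite dq bq aE cE /del; ring.
have CE : d ^+ q.+1 - a ^+ q.+1 = h2 * h0 * del.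
  by rewrite !exprS dq aq aE dE /del; ring.
have An : d ^+ q * b != a * c ^+ q by rewrite -subr_eq0 AE !mulf_neq0.
have uE : h2 * h1 * del / (h2 * h2 * del) = h1 / h2 by field; rewrite d0 h2n.
have vE : h2 * h0 * del / (h2 * h2 * del) = h0 / h2 by field; rewrite d0 h2n.
have [h10|h1n] := eqVneq h1 0; last first.
  constructor 3; split=> //; first by rewrite -subr_eq0 BE !mulf_neq0.
  rewrite AE BE CE uE vE expr_div_n h0E {2}h1E; field.
  by rewrite h2n expf_neq0.
have vbd : h0 / h2 = b ^+ q / d ^+ q.
  by rewrite bq dq h10 mul0r add0r; field; rewrite n1n h2n.
constructor 4; split=> //.
- by apply/eqP; rewrite -subr_eq0 BE h10 mulr0 mul0r.
- by rewrite AE CE vE.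
rewrite -vbd inE unity_rootE exprS expr_div_n {1}h2E {1}h0E; apply/eqP.
by field; rewrite l0 !expf_neq0.
Qed.

Theorem theorem1 (p m q : nat) (F : finFieldType) (a b c d : F)
  (hp : prime p) (hm : (0 < m)%N) (hq : q = (p ^ m)%N)
  (hF : #|F| = (q ^ 2)%N)
  (habcd : ~ [/\ a = 0, b = 0, c = 0 & d = 0])
  (g : {fraction {poly F}})
  (hg : g = (d ^+ q *: 'X^3 + c ^+ q *: 'X^2 + b ^+ q *: 'X + (a ^+ q)%:P)%:F
            / (a *: 'X^3 + b *: 'X^2 + c *: 'X + d%:P)%:F)
  (hdeg : ratdeg g = 1%N) :
  rat_permutes g (mu F q.+1) <->
  [\/ [/\ d = 0, c != 0, b * c ^+ q = a * b ^+ q & c ^+ q.+1 = a ^+ q.+1],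
      [/\ d = 0, a = 0 & c ^+ q.+1 != b ^+ q.+1],
      [/\ d != 0, d ^+ q * b != a * c ^+ q, d ^+ q * c != a * b ^+ q &
          ((d ^+ q * c - a * b ^+ q) / (d ^+ q * b - a * c ^+ q)) ^+ q
            * ((d ^+ q.+1 - a ^+ q.+1) / (d ^+ q * b - a * c ^+ q))
          = (d ^+ q * c - a * b ^+ q) / (d ^+ q * b - a * c ^+ q)] |
      [/\ d != 0, d ^+ q * b != a * c ^+ q, d ^+ q * c = a * b ^+ q,
          (d ^+ q.+1 - a ^+ q.+1) / (d ^+ q * b - a * c ^+ q)
            = b ^+ q / d ^+ q &
          b ^+ q / d ^+ q \in mu F q.+1]].
Proof.
have q0 : (0 < q)%N by rewrite hq expn_gt0 prime_gt0.
have qD (x y : F) : (x + y) ^+ q = x ^+ q + y ^+ q.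
  apply: exprDn_pchar; rewrite hq pnatX.
  have pF : p \in [pchar F].
    by apply: (@card_finPcharP F p (m * 2)); rewrite // hF hq expnM.
  by rewrite (eq_pnat _ (pcharf_eq pF)) pnat_id.
have qM : {morph (fun x : F => x ^+ q) : x y / x * y}.
  by move=> x y; apply: exprMn.
have qK (x : F) : x ^+ q ^+ q = x by rewrite -exprM mulnn -hF expf_card.
have cubicE (x3 x2 x1 x0 : F) :
    x3 *: 'X^3 + x2 *: 'X^2 + x1 *: 'X + x0%:P = Poly [:: x0; x1; x2; x3].
  by rewrite /= !cons_poly_def -!mul_polyC; ring.
rewrite !cubicE in hg.
have D0 : Poly [:: d; c; b; a] != 0.
  apply/eqP=> /polyP E; apply: habcd; split;
    [have:= E 3%N | have:= E 2%N | have:= E 1%N | have:= E 0%N];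
    by rewrite coef_Poly coef0.
have [h NE DE] := ratnum_ratden_factor D0 hg.
have del := ratdeg1_det hdeg; have [su sv] := ratdeg1_sizes hdeg.
(* One of the two reduced polynomials has degree exactly one, and the         *)
(* corresponding cubic has degree at most three.                              *)
have sh : (size h <= 3)%N.
  have h0 : h != 0 by apply: contraNneq D0 => h0; rewrite DE h0 mul0r.
  have bound (u : {poly F}) s : size s = 4%N -> Poly s = h * u ->
      (size u).-1 = 1%N -> (size h <= 3)%N.
    move=> ss E su1; have su2 : size u = 2%N.
      by case: (size u) su1 => [|[|[]]].
    have u0 : u != 0 by rewrite -size_poly_eq0 su2.
    by have := size_Poly s; rewrite E size_mul // su2 ss addn2.
  case: (leqP (size (ratnum g)).-1 (size (ratden g)).-1) => le.
    apply: (bound _ [:: d; c; b; a]) DE _ => //.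
    by rewrite -hdeg /ratdeg; symmetry; apply/maxn_idPr.
  apply: (bound _ [:: a ^+ q; b ^+ q; c ^+ q; d ^+ q]) NE _ => //.
  by rewrite -hdeg /ratdeg; symmetry; apply/maxn_idPl/ltnW.
have uE : ratnum g = Poly [:: (ratnum g)`_0; (ratnum g)`_1] := Poly_coefs su.
have vE : ratden g = Poly [:: (ratden g)`_0; (ratden g)`_1] := Poly_coefs sv.
have hE : h = Poly [:: h`_0; h`_1; h`_2] := Poly_coefs sh.
have NP : Poly [:: a ^+ q; b ^+ q; c ^+ q; d ^+ q] =
    Poly [:: h`_0; h`_1; h`_2] * Poly [:: (ratnum g)`_0; (ratnum g)`_1].
  by rewrite -hE -uE.
have DP : Poly [:: d; c; b; a] =
    Poly [:: h`_0; h`_1; h`_2] * Poly [:: (ratden g)`_0; (ratden g)`_1].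
  by rewrite -hE -vE.
have [l [le0 le1 ll [h2E h1E h0E]]] :=
  conj_star_factorization qD qM qK habcd del NP DP.
split=> _.
  exact: reduced_form_conditions q0 habcd del NP DP ll h2E h1E h0E.
exact: rat_permutes_mu q0 qD qK uE vE del le0 le1 ll.
Qed.
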